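(* Suppose that $G$ is a twin-free digraph of order $n$. Let $S$ be a dominating set of $G$ such that the $S$-partition of $V(G)\setminus S$ contains at least $x\cdot|S|$ parts (with $0<x\leq 1$). Then $\gamma_L(G)\leq\frac{2x+1}{3x+1}n$. Moreover, if $G$ is also quasi-twin-free, then $\gamma_L(G)\leq\frac{x+1}{2x+1}n$.
   Context: Digraphs are loopless without multiple arcs. A dominating set of a digraph $G$ is a set $D$ such that every vertex not in $D$ has an in-neighbour in $D$; it is locating-dominating if moreover every vertex not in $D$ has a distinct set of in-neighbours in $D$. $\gamma_L(G)$ is the minimum size of a locating-dominating set. Two vertices are twins if they have the same open in-neighbourhood or the same closed in-neighbourhood; $x,y$ are quasi-twins if $N^-(x)=N^-(y)\cup\{y\}$. For $S\subseteq V(G)$, the $S$-partition of $V(G)\setminus S$ is the partition where two vertices are in the same part iff they have the same set of in-neighbours in $S$. *)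

(* Defs.v *)
From mathcomp Require Import all_boot all_order all_algebra.

Set Implicit Arguments.
Unset Strict Implicit.
Unset Printing Implicit Defensive.

(* A digraph is a finite type T of vertices with an irreflexive arc relation
   e : rel T, where e u v reads "there is an arc from u to v".  Symmetry and
   antisymmetry are not required: opposite arcs u -> v and v -> u may coexist.
   Irreflexivity is a hypothesis of the statements, not of the definitions. *)
Section Digraph.
Variables (T : finType) (e : rel T).
Implicit Types (u v x y : T) (D S : {set T}).

Definition in_nbh v : {set T} := [set u | e u v].
Definition closed_in_nbh v : {set T} := v |: in_nbh v.

Definition dominating D : bool :=
  [forall v, (v \notin D) ==> [exists u in D, e u v]].

Definition locating D : bool :=
  [forall u, forall v, [&& u \notin D, v \notin D & u != v] ==>
     (in_nbh u :&: D != in_nbh v :&: D)].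

Definition locating_dominating D : bool := dominating D && locating D.

(* The full vertex set is locating-dominating, so this is a true minimum;
   see gammaLP. *)
Definition gammaL : nat :=
  #|[arg min_(D < [set: T] | locating_dominating D) #|D|]|.

Definition twins x y : bool :=
  (x != y) && ((in_nbh x == in_nbh y) || (closed_in_nbh x == closed_in_nbh y)).

(* Not symmetric; x = y is impossible when e is irreflexive. *)
Definition quasi_twins x y : bool := in_nbh x == in_nbh y :|: [set y].

Definition twin_free : Prop := forall x y, ~~ twins x y.
Definition quasi_twin_free : Prop := forall x y, ~~ quasi_twins x y.

Definition S_partition S : {set {set T}} :=
  preim_partition (fun v => in_nbh v :&: S) (~: S).

Lemma locating_dominating_setT : locating_dominating [set: T].
Proof.
apply/andP; split; first by apply/forallP => v; rewrite inE.
by apply/forallP => u; apply/forallP => v; rewrite !inE.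
Qed.

Lemma gammaLP :
  (exists2 D, locating_dominating D & #|D| = gammaL) /\
  (forall D, locating_dominating D -> gammaL <= #|D|).
Proof.
rewrite /gammaL; case: arg_minnP => [|D LD minD].
  exact: locating_dominating_setT.
by split; first exists D.
Qed.

End Digraph.

(* Main.v *)
(** For a dominating set [D], the complement of a transversal of the
    [D]-partition is locating-dominating, so [n - gammaL] is at least the number
    of [D]-parts.  Enlarge [S] to be maximal with at least [x * #|S|] parts, let
    [A] be the union of the parts of size at least 2 and [B] the union of the
    singleton parts.  Since [x <= 1], adding to [S] a vertex of [A] does not
    increase the number of parts, so a vertex of [A] separates no two other vertices of the
    same part.  Next take a maximal [C \subset B] such that [S :|: C] cuts [A]
    into at least [#|C|] classes.  No vertex outside [{u, v}] separates two
    vertices [u, v] of such a class, so [u] and [v] are quasi-twins; this forces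
    classes of size at most 2, and of size 1 without quasi-twins.  Hence
    [n - #|S|] is at most 3 (resp. 2) times the number of [S :|: C]-parts, and
    combining this with the bound [x * #|S|] gives the result. *)

Require Import Defs.
From mathcomp Require Import all_boot all_order all_algebra.
From mathcomp Require Import lra zify.
Import Order.TTheory GRing.Theory Num.Theory.

Set Implicit Arguments.
Unset Strict Implicit.
Unset Printing Implicit Defensive.

Lemma card_preim_partition (T rT : finType) (f : T -> rT) (D : {set T}) :
  #|preim_partition f D| = #|f @: D|.
Proof.
pose h c := [set y in D | c == f y].
have -> : preim_partition f D = h @: (f @: D) by rewrite -imset_comp.
apply: card_in_imset => _ c /imsetP[u uD ->] _ /setP/(_ u).
by rewrite !inE uD eqxx => /esym/eqP.
Qed.

Lemma leq_card_fiber_imset (T rT : finType) (f : T -> rT) (A : {set T}) k :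
  (forall y, #|[set z in A | f z == y]| <= k) -> #|A| <= k * #|f @: A|.
Proof.
move=> fib; rewrite -sum1_card (partition_big_imset f) mulnC -sum_nat_const.
apply: leq_sum => y _; apply: leq_trans (fib y).
by rewrite -sum1_card; under [leqRHS]eq_bigl do rewrite inE.
Qed.

Section Digraph.
Variables (T : finType) (e : rel T).
Implicit Types (u v w : T) (A B C D S : {set T}).

Definition trace D v := in_nbh e v :&: D.

Definition parts D := trace D @: ~: D.

Lemma card_S_partition D : #|S_partition e D| = #|parts D|.
Proof. exact: card_preim_partition. Qed.

Lemma trace_sub {D D' u v} :
  D \subset D' -> trace D' u = trace D' v -> trace D u = trace D v.
Proof.
move=> sDD' uv.
have H z : trace D z = trace D' z :&: D.
  by rewrite /trace -setIA (setIidPr sDD').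
by rewrite !H uv.
Qed.

Lemma traceP D u v :
  reflect {in D, forall w, e w u = e w v} (trace D u == trace D v).
Proof.
apply: (iffP eqP) => [uv w wD | uv].
  by move/setP/(_ w): uv; rewrite !inE wD !andbT.
by apply/setP => w; rewrite !inE; case wD: (w \in D); rewrite ?andbF ?uv.
Qed.

Lemma dominating_sub D D' :
  D \subset D' -> dominating e D -> dominating e D'.
Proof.
move=> sDD' /forallP dom; apply/forallP => v; apply/implyP => vD'.
have vD : v \notin D by apply: contra vD'; apply: (subsetP sDD').
have /existsP[u /andP[uD euv]] := implyP (dom v) vD.
by apply/existsP; exists u; rewrite (subsetP sDD').
Qed.

Lemma gammaL_parts D : dominating e D -> gammaL e + #|parts D| <= #|T|.
Proof.
move=> domD; rewrite -card_S_partition.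
have partP : partition (S_partition e D) (~: D) := preim_partitionP _ _.
pose X := transversal (S_partition e D) (~: D).
have trX : is_transversal X (S_partition e D) (~: D) := transversalP partP.
have sX : X \subset ~: D := transversal_sub trX.
rewrite -(card_transversal trX) -(cardsC X) [leqRHS]addnC leq_add2r.
have sDX : D \subset ~: X by rewrite subsetC.
apply: (proj2 (gammaLP e)); apply/andP; split.
  exact: dominating_sub domD.
apply/forallP => u; apply/forallP => v; apply/implyP => /and3P[].
rewrite !in_setC !negbK => uX vX; apply: contra => /eqP/(trace_sub sDX) uv.
apply/eqP/(pblock_inj trX) => //.
apply: same_pblock; first by case/and3P: partP.
rewrite pblock_equivalence_partition ?(subsetP sX) //.
  exact/eqP.
by split=> // /eqP->.
Qed.

Section Refine.
Variables D D' A A' : {set T}.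
Hypothesis sDD' : D \subset D'.
Hypothesis repr :
  forall v, v \in A -> exists2 v', v' \in A' & trace D v' = trace D v.

Let restrict : (fun X : {set T} => X :&: D) \o trace D' =1 trace D.
Proof. by move=> v; rewrite /= /trace -setIA (setIidPr sDD'). Qed.

Let sub_restrict :
  trace D @: A \subset (fun X : {set T} => X :&: D) @: (trace D' @: A').
Proof.
rewrite -imset_comp; apply/subsetP => _ /imsetP[v vA ->].
have [v' v'A <-] := repr vA; rewrite -restrict; exact: imset_f.
Qed.

(** Intersection with [D] maps the [D']-traces on [A'] onto a set containing all [D]-traces on [A].
    When the counts do not grow, this map must be injective. *)
Lemma trace_unsplit : #|trace D' @: A'| <= #|trace D @: A| ->
  {in A' &, forall u v, trace D u = trace D v -> trace D' u = trace D' v}.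
Proof.
move=> le u v uA vA uv.
have /imset_injP inj : #|(fun X : {set T} => X :&: D) @: (trace D' @: A')|
    == #|trace D' @: A'|.
  rewrite eqn_leq leq_imset_card.
  exact: leq_trans le (subset_leq_card sub_restrict).
by apply: inj; rewrite ?imset_f //; move: uv; rewrite -!restrict.
Qed.
End Refine.

Definition crowded S :=
  [set v in ~: S |
     [exists u, [&& u \notin S, u != v & trace S u == trace S v]]].

(** One-vertex form of the maximality of [S], free of the ratio [x]. *)
Definition saturated S :=
  forall w, w \notin S -> #|parts (w |: S)| <= #|parts S|.

(** A crowded [w] leaves a companion [w'] behind in its part, so every old part survives the move of
    [w] into [S]. If the number of parts does not increase, no part is split. *)
Lemma saturated_crowded S u v w : saturated S ->
  w \in crowded S -> u \notin w |: S -> v \notin w |: S ->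
  trace S u = trace S v -> e w u = e w v.
Proof.
move=> sat; rewrite !inE => /andP[wS /existsP[w' /and3P[w'S w'w /eqP tw']]].
move=> uwS vwS uv.
have repr z : z \in ~: S -> exists2 z', z' \in ~: (w |: S) & trace S z' = trace S z.
  rewrite inE => zS; have [->|zw] := eqVneq z w.
    by exists w' => //; rewrite !inE negb_or w'w.
  by exists z; rewrite // !inE negb_or zw.
suff /eqP/traceP : trace (w |: S) u = trace (w |: S) v by apply; rewrite setU11.
by apply: (trace_unsplit (subsetUr _ _) repr (sat w wS)); rewrite ?inE.
Qed.

(** A vertex alone in its [S]-part stays alone under any finer partition, so the vertices left
    outside [C] give singleton parts, distinct from those meeting [crowded S]. *)
Lemma leq_card_parts S C : C \subset ~: S :\: crowded S ->
  #|(~: S :\: crowded S) :\: C| + #|trace (S :|: C) @: crowded S|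
    <= #|parts (S :|: C)|.
Proof.
set A := crowded S; set B := _ :\: A => sCB; set D := S :|: C.
have sSD : S \subset D := subsetUl _ _.
have lone u v : u \in B -> v \notin S -> trace D v = trace D u -> v = u.
  rewrite !inE => /andP[]; case uS: (u \in S) => //= uA _ vS vu.
  apply: contraNeq uA => vu'; apply/existsP; exists v.
  by rewrite vS vu' (trace_sub sSD vu) eqxx.
have AS v : v \in A -> v \notin S by rewrite !inE => /andP[].
have BS v : v \in B -> v \notin S by rewrite !inE => /andP[].
rewrite -(@card_in_imset _ _ (trace D) (B :\: C)); last first.
  move=> u v /setDP[uB _] /setDP[vB _]; exact: lone (BS _ uB).
rewrite -cardsUI (_ : _ :&: _ = set0) ?cards0 ?addn0; last first.
  apply/setP => y; rewrite !inE; apply/negP => /andP[/imsetP[u /setDP[uB _] ->]].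
  move=> /imsetP[v vA] /esym/(lone _ _ uB (AS v vA)) vu.
  by move: uB; rewrite -vu => /setDP[_]; rewrite vA.
rewrite -imsetU; apply/subset_leq_card/imsetS/subsetP => v.
rewrite in_setU in_setC in_setU negb_or => /orP[/setDP[/BS-> ->]//|vA].
rewrite AS //=; apply: contraL vA => /(subsetP sCB).
by case/setDP.
Qed.

Hypothesis e_irr : irreflexive e.

(** With both arcs between them [u] and [v] would have equal closed in-neighbourhoods, with neither
    arc equal open ones. *)
Lemma agree_arcN u v : twin_free e -> u != v ->
  (forall w, w != u -> w != v -> e w u = e w v) -> e u v != e v u.
Proof.
move=> tf uv agr; apply/eqP => uvu; have /negP := tf u v; apply.
rewrite /twins uv /=; case euv: (e u v) uvu => evu.
  apply/orP; right; apply/eqP/setP => w; rewrite !inE.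
  have [->|wu] := eqVneq w u; first by rewrite euv orbT.
  by have [->|wv] := eqVneq w v; rewrite ?orbT -?evu //=; exact: agr.
apply/orP; left; apply/eqP/setP => w; rewrite !inE.
have [->|wu] := eqVneq w u; first by rewrite euv e_irr.
by have [->|wv] := eqVneq w v; rewrite -?evu ?e_irr //; exact: agr.
Qed.

Lemma agree_quasi_twins u v : u != v ->
  (forall w, w != u -> w != v -> e w u = e w v) ->
  e u v -> ~~ e v u -> quasi_twins e v u.
Proof.
move=> uv agr euv evu; apply/eqP/setP => w; rewrite !inE.
have [->|wu] := eqVneq w u; first by rewrite euv orbT.
have [->|wv] := eqVneq w v; first by rewrite e_irr (negbTE evu).
by rewrite orbF agr.
Qed.

Lemma saturated_parts S : saturated S -> twin_free e ->
  exists D, [/\ S \subset D, #|~: S| <= 3 * #|parts D| &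
    quasi_twin_free e -> #|~: S| <= 2 * #|parts D|].
Proof.
move=> sat tf; set A := crowded S; pose B := ~: S :\: A.
pose ok C := (C \subset B) && (#|C| <= #|trace (S :|: C) @: A|).
have ok0 : ok set0 by rewrite /ok sub0set cards0.
case: (arg_maxnP (fun C : {set T} => #|C|) ok0) => C /andP[sCB leC] maxC.
pose D := S :|: C; exists D.
have sAS : A \subset ~: S by apply/subsetP => v; rewrite inE => /andP[].
have cardS : #|~: S| = #|A| + #|B| by rewrite -(cardsID A) (setIidPr sAS).
have cardB : #|B| = #|C| + #|B :\: C| by rewrite -(cardsID C) (setIidPr sCB).
have := leq_card_parts sCB; rewrite -/A -/B -/D => leP.
have agree u v : u \in A -> v \in A -> trace D u = trace D v ->
    forall w, w != u -> w != v -> e w u = e w v.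
  move=> uA vA uv w wu wv.
  have [wD|wD] := boolP (w \in D); first by move/eqP/traceP: uv; apply.
  have [wS wC] : w \notin S /\ w \notin C.
    by apply/andP; rewrite -negb_or -in_setU.
  have AwS z : z \in A -> w != z -> z \notin w |: S.
    by move=> /(subsetP sAS); rewrite !inE negb_or eq_sym => -> ->.
  have [wA|wA] := boolP (w \in A).
    apply: (saturated_crowded sat wA); rewrite ?AwS //.
    exact: trace_sub (subsetUl _ _) uv.
  have wB : w \in B by rewrite !inE wS andbT; move: wA; rewrite !inE wS.
  suff /eqP/traceP : trace (w |: D) u = trace (w |: D) v by apply; rewrite setU11.
  have repr z : z \in A -> exists2 z', z' \in A & trace D z' = trace D z.
    by move=> zA; exists z.
  apply: (trace_unsplit (subsetUr _ _) repr _ uA vA uv).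
  (* If [w] raised the number of classes of [A] above [#|C|], then [w |: C] would satisfy [ok],
     against the maximality of [C]. *)
  apply: leq_trans leC; rewrite -ltnS ltnNge; apply/negP => lt.
  have := maxC (w |: C); rewrite /ok subUset sub1set wB sCB cardsU1 wC /=.
  by rewrite setUCA => /(_ lt); rewrite add1n ltnn.
(* Three vertices in one class would induce a tournament in which each vertex dominates both others
   or neither: out-degrees 0 or 2 cannot sum to 3. *)
have le2 : #|A| <= 2 * #|trace D @: A|.
  apply: leq_card_fiber_imset => y; rewrite leqNgt; apply/negP => /card_gt2P.
  move=> [u [v [w [[/setIdP[uA /eqP uy] /setIdP[vA /eqP vy] /setIdP[wA /eqP wy]]]]]].
  move=> [uv vw wu].
  have uvE : trace D u = trace D v by rewrite uy.
  have vwE : trace D v = trace D w by rewrite vy.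
  have wuE : trace D w = trace D u by rewrite wy.
  have := agree _ _ uA vA uvE w wu; rewrite eq_sym vw => /(_ isT).
  have := agree _ _ vA wA vwE u uv; rewrite eq_sym wu => /(_ isT).
  have := agree _ _ wA uA wuE v vw; rewrite eq_sym uv => /(_ isT).
  have := agree_arcN tf wu (agree _ _ wA uA wuE).
  have := agree_arcN tf vw (agree _ _ vA wA vwE).
  have := agree_arcN tf uv (agree _ _ uA vA uvE).
  by case: (e u v) (e v u) (e v w) (e w v) (e w u) (e u w) => [] [] [] [] [] [].
have eq1 : quasi_twin_free e -> #|A| = #|trace D @: A|.
  move=> qtf; apply/esym/card_in_imset => u v uA vA uv.
  apply/eqP; apply: contraT => neq; have agr := agree _ _ uA vA uv.
  have := agree_arcN tf neq agr.
  case euv: (e u v); case evu: (e v u) => // _.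
    by case/negP: (qtf v u); apply: agree_quasi_twins; rewrite ?euv ?evu.
  case/negP: (qtf u v); apply: agree_quasi_twins; rewrite ?euv ?evu 1?eq_sym //.
  by move=> w wv wu; rewrite agr.
rewrite -/D in leC.
(* With [k] classes on [A]: [#|C| <= k], and [#|A|] is at most [2k] (resp. equal to [k]), while [D]
   has at least [#|B :\: C| + k] parts. *)
split; [exact: subsetUl | lia |].
by move=> /eq1; lia.
Qed.
End Digraph.

Local Open Scope ring_scope.

Theorem theorem8 (R : realFieldType) (T : finType) (e : rel T) (n : nat)
    (S : {set T}) (x : R)
    (e_irr : irreflexive e)
    (order_G : #|T| = n)
    (G_twin_free : twin_free e)
    (S_dom : dominating e S)
    (x_gt0 : 0 < x) (x_le1 : x <= 1)
    (S_parts : x * #|S|%:R <= #|S_partition e S|%:R) :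
  (gammaL e)%:R <= (2 * x + 1) / (3 * x + 1) * n%:R
  /\ (quasi_twin_free e ->
      (gammaL e)%:R <= (x + 1) / (2 * x + 1) * n%:R).
Proof.
pose ok (S' : {set T}) :=
  dominating e S' && (x * #|S'|%:R <= #|parts e S'|%:R).
have okS : ok S by rewrite /ok S_dom -card_S_partition.
case: (arg_maxnP (fun S' : {set T} => #|S'|) okS).
move=> S1 /andP[S1_dom S1_parts] maxS1.
have sat : saturated e S1.
  move=> w wS1; rewrite leqNgt; apply/negP => lt.
  (* A new part would pay for [w]: the required bound grows by [x <= 1] only, so [w |: S1] would
     satisfy [ok]. *)
  have /contraFN := maxS1 (w |: S1); rewrite /geq /= cardsU1 wS1 add1n ltnn.
  move=> /(_ erefl)/negP; apply; rewrite /ok cardsU1 wS1 natrD.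
  rewrite (dominating_sub (subsetUr _ _)) //= mulrDr mulr1.
  rewrite -(ler_nat R) -natr1 in lt; lra.
have [D [sS1D le3 le2]] := saturated_parts e_irr sat G_twin_free.
have gS := gammaL_parts S1_dom.
have gD := gammaL_parts (dominating_sub sS1D S1_dom).
have cS := cardsC S1; rewrite order_G in gS gD cS.
pose m := (n - gammaL e)%N.
have mE : (gammaL e)%:R = n%:R - m%:R :> R by rewrite /m natrB; [lra | lia].
have xm : x * #|S1|%:R <= m%:R :> R.
  by apply: le_trans S1_parts _; rewrite ler_nat /m; lia.
rewrite mE; split=> [|/le2 {}le2].
  (* Multiplying by [x] and using [xm] gives [x * n <= (3 * x + 1) * m]; subtract from [n]. The
     other case has 2 in place of 3. *)
  have : n%:R <= #|S1|%:R + 3 * m%:R :> R by rewrite -natrM -natrD ler_nat /m; lia.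
  by rewrite mulrAC ler_pdivlMr => [?|]; nra.
have : n%:R <= #|S1|%:R + 2 * m%:R :> R by rewrite -natrM -natrD ler_nat /m; lia.
by rewrite mulrAC ler_pdivlMr => [?|]; nra.
Qed.
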